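(* Let $n\ge2$ and let $V,V'$ be nonzero finite-dimensional vector superspaces over $\mathbb F$, each satisfying: (its odd dimension is at least $n$ if its even dimension is $0$) and ($\operatorname{char}\mathbb F=0$ or $\operatorname{char}\mathbb F>n$ if its even dimension is positive). Write $d_{\bar0},d_{\bar1}$ (resp. $d'_{\bar0},d'_{\bar1}$) for the even and odd dimensions of $V$ (resp. $V'$), $d=d_{\bar0}+d_{\bar1}$, $d'=d'_{\bar0}+d'_{\bar1}$. Let $\mathcal B=\{v_i\}_{i=1}^d$ and $\mathcal B'=\{v'_i\}_{i=1}^{d'}$ be parity-ordered bases of $V$ and $V'$, and let $\{\check e_I\}_{I\in\check{\mathcal I}_n(V)}$ and $\{\check e'_{I'}\}_{I'\in\check{\mathcal I}_n(V')}$ be the associated bases of $\bigvee^nV$ and $\bigvee^nV'$. Then: 1) Let $w_1,\dots,w_n\in V$ with $w_j\in V_{\bar0}$ for $j\le r$ and $w_j\in V_{\bar1}$ for $j>r$, for some $r$ with $0\le n-r\le\min(d_{\bar1},n)$, and write $w_j=\sum_{i=1}^da_{ij}v_i$, $A=(a_{ij})=\mathrm{diag}(A_{\bar0},A_{\bar1})\in\mathcal M_{d\times n}(\mathbb F)$ (an even supermatrix of type $(d_{\bar0}|d_{\bar1})\times(r|n-r)$). With $J=(1,\dots,n)$, $$\vee_jw_j=\sum_{I\in\check{\mathcal I}_n(V)}\check{\mathcal M}_{I,J}(A)\,\check e_I,$$ where $\check{\mathcal M}_{I,J}(A)=0$ if $I\notin\check{\mathcal I}^{(r,n-r)}(V)$.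 2) Let $h\colon V\to V'$ be an even linear map with coordinate matrix $A=(a_{ij})=\mathrm{diag}(A_{\bar0},A_{\bar1})\in\mathcal M_{d'\times d}(\mathbb F)$ with respect to $\mathcal B$ and $\mathcal B'$. Then the coordinate matrix of $h^{\vee n}\colon\bigvee^nV\to\bigvee^nV'$, $\vee_ix_i\mapsto\vee_ih(x_i)$, in the associated bases is $$A^{\vee n}:=\big(\check{\mathcal M}_{I',I}(A)\big)_{I'\in\check{\mathcal I}_n(V'),\,I\in\check{\mathcal I}_n(V)}.$$ (Here $\check{\mathcal M}_{I',I}(A)=0$ if $I\in\check{\mathcal I}^{(r,n-r)}(V)$, $I'\in\check{\mathcal I}^{(s,n-s)}(V')$ with $r\ne s$.)
   Context: $\mathbb F$ is a field with $\operatorname{char}\mathbb F\neq2$. Vector superspaces are $\mathbb Z_2$-graded; $\eta_{x,y}=(-1)^{\varepsilon(x)\varepsilon(y)}$ with $\varepsilon$ the parity. A parity-ordered basis lists even basis vectors first, then odd ones. $S_n$ acts on $V^{\otimes n}$ with $(i\ \,i{+}1)$ acting by $v_1\otimes\dots\otimes v_n\mapsto\eta_{v_i,v_{i+1}}v_1\otimes\dots\otimes v_{i+1}\otimes v_i\otimes\dots\otimes v_n$; $\bigvee^nV$ is the quotient of $V^{\otimes n}$ by the span of all $v-\sigma\cdot v$, and $\vee_iv_i=v_1\vee\dots\vee v_n$ is the class of $\otimes_iv_i$. $\check{\mathcal I}^{(k,n-k)}(V)$ ($0\le n-k\le\min(d_{\bar1},n)$) is the set of tuples $I=(i_1,\dots,i_n)$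 with $1\le i_1\le\dots\le i_k\le d_{\bar0}<i_{k+1}<\dots<i_n\le d$, and $\check{\mathcal I}_n(V)$ is their union over $k$. $\check e_I=v_{i_1}\vee\dots\vee v_{i_n}$; under the stated hypotheses these form a basis of $\bigvee^nV$. For $I\in\check{\mathcal I}^{(k,n-k)}(V)$ and $\sigma\in S_n$, $\check{\mathrm{sgn}}_{k,n-k}(\sigma)\in\{\pm1\}$ is the sign defined by $v_{i_1}\vee\dots\vee v_{i_n}=\check{\mathrm{sgn}}_{k,n-k}(\sigma)\,v_{i_{\sigma(1)}}\vee\dots\vee v_{i_{\sigma(n)}}$ (it is determined by the relations $x\vee y=\eta_{x,y}y\vee x$). $S_n(I)\subseteq S_n$ denotes a set of permutations such that $(i_{\sigma(1)},\dots,i_{\sigma(n)})$, $\sigma\in S_n(I)$, runs through each distinct rearrangement of $I$ exactly once. For $I=(i_1,\dots,i_n)\in\check{\mathcal I}^{(p,n-p)}$ (row indices), $J=(j_1,\dots,j_n)$ (column indices, listed with even columns first, weakly increasing on even and increasing on odd ones) and an even (block diagonal) supermatrix $A=(a_{ij})$, the symmetric $(I,J)$-superminor is $$\check{\mathcal M}_{I,J}(A)=\sum_{\sigma\in S_n(I)}\check{\mathrm{sgn}}_{p,n-p}(\sigma)\prod_{t=1}^na_{i_{\sigma(t)},j_t}.$$ *)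

(* Defs.v *)
From HB Require Import structures.
From mathcomp Require Import all_boot all_order all_algebra all_fingroup.
From mathcomp Require Import zify.

Set Implicit Arguments.
Unset Strict Implicit.
Unset Printing Implicit Defensive.

Import GRing.Theory.
Local Open Scope ring_scope.

(* Finite-dimensional vector superspaces; parities are booleans, with [true]
   for odd. *)
Record superspace (F : fieldType) := Superspace {
  ssort :> vectType F;
  spart : bool -> {vspace ssort};
  spart_add : (spart false + spart true = fullv)%VS;
  spart_cap : (spart false :&: spart true = 0)%VS
}.

Definition sdim (F : fieldType) (V : superspace F) (b : bool) : nat :=
  \dim (spart V b).

Notation sdimT V := (sdim V false + sdim V true)%N.

(* Indices of basis vectors are counted from 0, so that index [i] of a
   parity-ordered basis is odd iff [sdim V false <= i]. *)
Definition ipar (F : fieldType) (V : superspace F) (i : 'I_(sdimT V)) : bool :=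
  (sdim V false <= i)%N.

Definition parity_basis (F : fieldType) (V : superspace F)
    (B : (sdimT V).-tuple V) : Prop :=
  basis_of fullv B /\ (forall i, tnth B i \in spart V (ipar i)).

Section TensorPower.

Variables (F : fieldType) (V : superspace F) (n : nat).

(* V^{\otimes n} is modelled by coordinate arrays with respect to one fixed
   homogeneous basis of V; it is characterized independently of that basis by
   [tens_multilinear], [tliftE] and [tlift_unique] below. *)
Definition hbasis : (sdimT V).-tuple V :=
  [tuple of vbasis (spart V false) ++ vbasis (spart V true)].

Definition multi_index := {ffun 'I_n -> 'I_(sdimT V)}.

Definition tpow : vectType F := {ffun multi_index -> F^o}.

Definition tens (x : {ffun 'I_n -> V}) : tpow :=
  [ffun f : multi_index => \prod_(t < n) coord hbasis (f t) (x t)].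

Definition upd (T : Type) (x : {ffun 'I_n -> T}) (t : 'I_n) (u : T) :
    {ffun 'I_n -> T} := [ffun s => if s == t then u else x s].

Definition multilinear (W : lmodType F) (phi : {ffun 'I_n -> V} -> W) : Prop :=
  forall x t a u v,
    phi (upd x t (a *: u + v)) = a *: phi (upd x t u) + phi (upd x t v).

Definition tlift (W : lmodType F) (phi : {ffun 'I_n -> V} -> W) (T : tpow) : W :=
  \sum_(f : multi_index) (T f : F) *: phi [ffun t => tnth hbasis (f t)].

Fact tlift_is_linear (W : lmodType F) (phi : {ffun 'I_n -> V} -> W) :
  linear (tlift phi).
Proof.
move=> a x y; rewrite /tlift scaler_sumr -big_split; apply: eq_bigr => f _ /=.
by rewrite !ffunE scalerDl scalerA.
Qed.
HB.instance Definition _ (W : lmodType F) (phi : {ffun 'I_n -> V} -> W) :=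
  GRing.isSemilinear.Build F tpow W _ (tlift phi)
    (GRing.semilinear_linear (tlift_is_linear phi)).

(* Exponent of the sign produced when [s] moves the factor at position t,
   of parity [p t], to position [s t]: each pair of odd factors which changes
   its relative order contributes a factor -1. *)
Definition koszul (p : 'I_n -> bool) (s : 'S_n) : bool :=
  \big[addb/false]_(ab : 'I_n * 'I_n | (ab.1 < ab.2)%N && (s ab.2 < s ab.1)%N)
     (p ab.1 && p ab.2).

(* The action of S_n on the tensor power; see [tact1], [tactM] and
   [tact_adjacent].  The product of 'S_n composes from left to right. *)
Definition tact (s : 'S_n) (T : tpow) : tpow :=
  [ffun g : multi_index =>
     (-1) ^+ koszul (fun t => ipar (g (s t))) s * T [ffun t => g (s t)] : F^o].

Fact tact_is_linear s : linear (tact s).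
Proof.
move=> a x y; apply/ffunP=> g; rewrite !ffunE /= mulrDr; congr (_ + _).
by rewrite [LHS]mulrCA.
Qed.
HB.instance Definition _ s :=
  GRing.isSemilinear.Build F tpow tpow _ (tact s)
    (GRing.semilinear_linear (tact_is_linear s)).

(* The span of all v - s . v *)
Definition vrel : {vspace tpow} :=
  (\sum_(s : 'S_n) limg (\1 - linfun (tact s))%VF)%VS.

(* The quotient of the tensor power by [vrel], realized on the complement
   [vrel^C]; see [vclass_eq0] and [vclassK]. *)
Definition vpow : vectType F := subvs_of (vrel^C)%VS.

Definition vclass (T : tpow) : vpow :=
  vsproj (vrel^C)%VS (daddv_pi (vrel^C)%VS vrel T).

Fact vclass_is_linear : linear vclass.
Proof. by move=> a x y; rewrite /vclass !linearP. Qed.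
HB.instance Definition _ :=
  GRing.isSemilinear.Build F tpow vpow _ vclass
    (GRing.semilinear_linear vclass_is_linear).

Definition vee (x : {ffun 'I_n -> V}) : vpow := vclass (tens x).

(* Index tuples of type (k, n-k) *)
Definition cI (k : nat) : {set multi_index} :=
  [set I : multi_index |
     [&& (k <= n)%N, (n - k <= minn (sdim V true) n)%N,
         [forall a : 'I_n, ipar (I a) == (k <= a)%N],
         [forall a : 'I_n, forall b : 'I_n,
            ((a < b)%N && (b < k)%N) ==> (I a <= I b)%N] &
         [forall a : 'I_n, forall b : 'I_n,
            ((k <= a)%N && (a < b)%N) ==> (I a < I b)%N]]].

Definition cIn : {set multi_index} := \bigcup_(k < n.+1) cI k.

Variable B : (sdimT V).-tuple V.

Definition veeB (I : multi_index) : vpow := vee [ffun t => tnth B (I t)].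

(* The associated basis of the symmetric power, in the order of the
   enumeration of [cIn]; see [ebasis_basis]. *)
Definition ebasis : #|cIn|.-tuple vpow := [tuple veeB (enum_val i) | i < #|cIn|].

Definition permI (I : multi_index) (s : 'S_n) : multi_index :=
  [ffun t => I (s t)].

(* The sign +-1 such that v_I = sign * v_{I o s}; for I in [cIn] and B a
   parity-ordered basis it exists and is unique ([csgnE], [csgn_unique]), and
   depends only on the type of I and on s ([csgn_type]). *)
Definition csgn (I : multi_index) (s : 'S_n) : F :=
  (-1) ^+ odflt false
            [pick b : bool | veeB I == (-1) ^+ b *: veeB (permI I s)].

(* S is a possible choice for the set S_n(I). *)
Definition rearrangements (I : multi_index) (S : {set 'S_n}) : Prop :=
  {in S &, injective (permI I)} /\
  (forall s : 'S_n, exists2 t, t \in S & permI I t = permI I s).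

Definition superminor (S : {set 'S_n}) (c : nat) (A : 'M[F]_(sdimT V, c))
    (I : multi_index) (J : {ffun 'I_n -> 'I_c}) : F :=
  \sum_(s in S) csgn I s * \prod_(t < n) A (I (s t)) (J t).

End TensorPower.

Arguments ebasis {F V} n B.

Definition even_map (F : fieldType) (V V' : superspace F) (h : 'Hom(V, V')) :
    Prop :=
  forall b, (h @: spart V b <= spart V' b)%VS.

(* h^{\vee n}; see [vee_mapE]. *)
Definition vee_map (F : fieldType) (V V' : superspace F) (n : nat)
    (h : 'Hom(V, V')) : 'Hom(vpow V n, vpow V' n) :=
  linfun (@vclass F V' n
            \o tlift (fun y : {ffun 'I_n -> V} => tens [ffun t => h (y t)])
            \o vsval).

Definition coordmx (F : fieldType) (U W : vectType F) (m p : nat)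
    (e : m.-tuple U) (e' : p.-tuple W) (h : 'Hom(U, W)) : 'M[F]_(p, m) :=
  \matrix_(i < p, j < m) coord e' i (h (tnth e j)).

Definition vee_mx (F : fieldType) (V V' : superspace F) (n : nat)
    (B' : (sdimT V').-tuple V')
    (S' : multi_index V' n -> {set 'S_n})
    (A : 'M[F]_(sdimT V', sdimT V)) : 'M[F]_(#|cIn V' n|, #|cIn V n|) :=
  \matrix_(i < #|cIn V' n|, j < #|cIn V n|)
     superminor B' (S' (enum_val i)) A (enum_val i) (enum_val j).

Definition dim_hyp (F : fieldType) (V : superspace F) (n : nat) : Prop :=
  (sdim V false = 0%N -> (n <= sdim V true)%N) /\
  ((0 < sdim V false)%N ->
     [pchar F] =i pred0 \/ exists2 p, p \in [pchar F] & (n < p)%N).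

Section TensorTheory.

Variables (F : fieldType) (V : superspace F) (n : nat).

Lemma hbasis_basis : basis_of fullv (hbasis V).
Proof.
rewrite /hbasis -spart_add; apply: cat_basis; try exact: vbasisP.
by apply/directv_addP; rewrite spart_cap.
Qed.

Lemma hbasis_parity : parity_basis (hbasis V).
Proof.
split=> [|i]; first exact: hbasis_basis.
rewrite (tnth_nth 0) /= nth_cat size_tuple /ipar {2}/sdim.
case: leqP => hi; apply: vbasis_mem; apply: mem_nth; rewrite size_tuple //.
by rewrite ltn_subLR // (ltn_ord i).
Qed.

Lemma updid (T : Type) (x : {ffun 'I_n -> T}) t : upd x t (x t) = x.
Proof. by apply/ffunP=> s; rewrite ffunE; case: eqP => [->|]. Qed.

Lemma multilinear_sum (W : lmodType F) (phi : {ffun 'I_n -> V} -> W) x t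
    (d : nat) (c : 'I_d -> F) (b : 'I_d -> V) : multilinear phi ->
  phi (upd x t (\sum_i c i *: b i)) = \sum_i c i *: phi (upd x t (b i)).
Proof.
move=> phiP.
have phi0 : phi (upd x t 0) = 0.
  have := phiP x t 1 0 0; rewrite !scale1r add0r => /eqP.
  by rewrite -subr_eq subrr eq_sym => /eqP.
by elim/big_rec2: _ => [//|i y1 y2 _ <-]; rewrite phiP.
Qed.

Lemma multilinear_eq0 (W : lmodType F) (phi : {ffun 'I_n -> V} -> W)
    (B : (sdimT V).-tuple V) : basis_of fullv B -> multilinear phi ->
  (forall f : multi_index V n, phi [ffun t => tnth B (f t)] = 0) ->
  forall x, phi x = 0.
Proof.
move=> hB phiP phi0.
suff H m (x : {ffun 'I_n -> V}) : (forall t : 'I_n, (m <= t)%N -> exists i, x t = tnth B i) ->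
    phi x = 0.
  by move=> x; apply: (H n) => t; rewrite leqNgt ltn_ord.
elim: m x => [|m IH] x hx.
  have /fin_all_exists[f hf] t : exists i, x t = tnth B i by apply: hx.
  rewrite -(phi0 [ffun t => f t]); congr phi; apply/ffunP=> t.
  by rewrite !ffunE hf.
case: (ltnP m n) => hm; last first.
  by apply: IH => t; rewrite leqNgt (leq_trans (ltn_ord t)).
pose t0 := Ordinal hm.
rewrite -(updid x t0) (coord_basis hB (memvf (x t0))) multilinear_sum //.
rewrite big1 // => i _; rewrite IH ?scaler0 // => t ht; rewrite ffunE.
case: eqP => [_|/eqP ne]; first by exists i; rewrite (tnth_nth 0).
by apply: hx; rewrite ltn_neqAle ht andbT eq_sym.
Qed.

Lemma tens_multilinear : multilinear (@tens F V n).
Proof.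
move=> x t a u v; apply/ffunP=> f; rewrite !ffunE.
have E w : \prod_(s < n) coord (hbasis V) (f s) (upd x t w s) =
  coord (hbasis V) (f t) w * \prod_(s < n | s != t) coord (hbasis V) (f s) (x s).
  rewrite (bigD1 t) //= ffunE eqxx; congr (_ * _); apply: eq_bigr => s /negPf.
  by rewrite ffunE => ->.
by rewrite !E linearP /= mulrDl -mulrA.
Qed.

Lemma tens_hbasis (f g : multi_index V n) :
  tens [ffun t => tnth (hbasis V) (f t)] g = (g == f)%:R.
Proof.
rewrite ffunE; case: eqP => [->|ne].
  rewrite big1 // => t _; rewrite ffunE (tnth_nth 0) coord_free ?eqxx //.
  exact: basis_free hbasis_basis.
have [t ht] : exists t, g t != f t.
  apply/existsP; rewrite -negb_forall; apply/negP=> /forallP h; apply: ne.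
  by apply/ffunP=> t; apply/eqP/h.
rewrite (bigD1 t) //= ffunE (tnth_nth 0) coord_free.
  by rewrite eq_sym (negPf ht) mul0r.
exact: basis_free hbasis_basis.
Qed.

Lemma tlift_hbasis (W : lmodType F) (phi : {ffun 'I_n -> V} -> W)
    (f : multi_index V n) :
  tlift phi (tens [ffun t => tnth (hbasis V) (f t)]) =
  phi [ffun t => tnth (hbasis V) (f t)].
Proof.
rewrite /tlift (bigD1 f) //= tens_hbasis eqxx scale1r big1 ?addr0 // => g ne.
by rewrite tens_hbasis (negPf ne) scale0r.
Qed.

Lemma multilinear_ext (W : lmodType F) (phi psi : {ffun 'I_n -> V} -> W)
    (B : (sdimT V).-tuple V) : basis_of fullv B ->
  multilinear phi -> multilinear psi ->
  (forall f : multi_index V n,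
     phi [ffun t => tnth B (f t)] = psi [ffun t => tnth B (f t)]) ->
  phi =1 psi.
Proof.
move=> hB h1 h2 e x; apply/eqP; rewrite -subr_eq0; apply/eqP.
apply: (@multilinear_eq0 _ (fun x => phi x - psi x) _ hB) => [y t a u v|f].
  by rewrite h1 h2 scalerBr opprD addrACA.
by rewrite e subrr.
Qed.

Lemma multilinear_comp (W W' : lmodType F) (g : {linear W -> W'})
    (phi : {ffun 'I_n -> V} -> W) :
  multilinear phi -> multilinear (fun x => g (phi x)).
Proof. by move=> h x t a u v; rewrite h linearP. Qed.

(* [tliftE] and [tlift_unique] are the universal property of the tensor
   power. *)
Lemma tliftE (W : lmodType F) (phi : {ffun 'I_n -> V} -> W) :
  multilinear phi -> forall x, tlift phi (tens x) = phi x.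
Proof.
move=> phiP.
apply: (multilinear_ext (phi := fun x => tlift phi (tens x)) hbasis_basis
          _ phiP) => [|f]; last exact: tlift_hbasis.
exact: multilinear_comp tens_multilinear.
Qed.

Lemma tpow_sum (T : tpow V n) :
  T = \sum_(f : multi_index V n)
        (T f : F) *: tens [ffun t => tnth (hbasis V) (f t)].
Proof.
apply/ffunP=> g; rewrite sum_ffunE (bigD1 g) //= big1 => [|f ne].
  by rewrite ffunE tens_hbasis eqxx addr0 [RHS]mulr1.
by rewrite ffunE tens_hbasis eq_sym (negPf ne) [LHS]mulr0.
Qed.

Lemma tlift_unique (W : lmodType F) (phi : {ffun 'I_n -> V} -> W)
    (g : {linear tpow V n -> W}) :
  (forall x, g (tens x) = phi x) -> g =1 tlift phi.
Proof.
move=> gP T; rewrite {1}[T]tpow_sum linear_sum; apply: eq_bigr => f _.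
by rewrite linearZ gP.
Qed.

End TensorTheory.

Section ActionTheory.

Variables (F : fieldType) (V : superspace F) (n : nat).

Lemma coord_parity (B : (sdimT V).-tuple V) b v i : parity_basis B ->
  v \in spart V b -> ipar i != b -> coord B i v = 0.
Proof.
move=> [hB Bp] vb ib; pose u := \sum_(j | ipar j != b) coord B j v *: B`_j.
have u0 : u = 0.
  apply/eqP; rewrite -memv0 -(spart_cap V).
  have u1 : u \in spart V b.
    suff -> : u = v - \sum_(j | ipar j == b) coord B j v *: B`_j.
      apply: memvB => //; apply: memv_suml => j /eqP jb; apply: memvZ.
      by rewrite -jb -tnth_nth.
    apply/eqP; rewrite eq_sym subr_eq addrC {1}(coord_basis hB (memvf v)).
    by rewrite (bigID (fun j => ipar j == b)).
  have u2 : u \in spart V (~~ b).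
    apply: memv_suml => j jb; apply: memvZ.
    have -> : ~~ b = ipar j by move: jb; case: (ipar j); case: (b).
    by rewrite -tnth_nth.
  by rewrite memv_cap; move: u1 u2; case: (b) => /= -> ->.
pose k j := if ipar j != b then coord B j v else 0.
have k0 : \sum_j k j *: B`_j = 0.
  transitivity u => //; rewrite /u [RHS]big_mkcond; apply: eq_bigr => j _.
  by rewrite /k; case: ifP => //; rewrite scale0r.
by have /freeP/(_ k k0 i) := basis_free hB; rewrite /k ib.
Qed.

Lemma perm_eq_nat (s : 'S_n) (a b : 'I_n) :
  (s a == s b :> nat) = (a == b :> nat).
Proof. by rewrite !val_eqE (inj_eq perm_inj). Qed.

Lemma koszul_sum_sym (s : 'S_n) (H : 'I_n -> 'I_n -> bool) :
  (forall a b, H a b = H b a) ->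
  \big[addb/false]_(ab : 'I_n * 'I_n | (ab.1 < ab.2)%N) H (s ab.1) (s ab.2) =
  \big[addb/false]_(ab : 'I_n * 'I_n | (ab.1 < ab.2)%N) H ab.1 ab.2.
Proof.
move=> Hs; pose f (ab : 'I_n * 'I_n) := (s^-1 ab.1, s^-1 ab.2)%g.
have fb : bijective f.
  by exists (fun ab => (s ab.1, s ab.2)) => [] [a b]; rewrite /f /= ?permK ?permKV.
rewrite (reindex f) /=; last exact: onW_bij.
under eq_bigr do rewrite !permKV.
rewrite (bigID (fun ab : 'I_n * 'I_n => (ab.1 < ab.2)%N)) /=.
rewrite [in RHS](bigID (fun ab => ((f ab).1 < (f ab).2)%N)) /=; congr (_ (+) _).
  by apply: eq_bigl => ab; rewrite andbC.
pose g (ab : 'I_n * 'I_n) := (ab.2, ab.1).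
have gb : bijective g by exists g => [] [].
rewrite (reindex g) /=; last exact: onW_bij.
apply: eq_big => [[a b]|[a b] _] //=.
by have := perm_eq_nat s^-1 a b; lia.
Qed.

Lemma koszulM (q : 'I_n -> bool) (s u : 'S_n) :
  koszul (fun t => q (s t)) (s * u)%g =
  koszul (fun t => q (s t)) s (+) koszul q u.
Proof.
rewrite /koszul !big_mkcondr.
pose H (a b : 'I_n) := ((a < b)%N (+) (u a < u b)%N) && (q a && q b).
have Hs (a b : 'I_n) : H a b = H b a.
  rewrite /H [q b && _]andbC; case: (eqVneq a b) => [->|ne] //.
  congr (_ && _).
  by rewrite -val_eqE /= in ne; have := perm_eq_nat u a b; lia.
have key : \big[addb/false]_(ab : 'I_n * 'I_n | (ab.1 < ab.2)%N)
    (if (u ab.2 < u ab.1)%N then q ab.1 && q ab.2 else false) =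
  \big[addb/false]_(ab : 'I_n * 'I_n | (ab.1 < ab.2)%N) H (s ab.1) (s ab.2).
  rewrite koszul_sum_sym //; apply: eq_bigr => [[a b]] /= ab.
  rewrite /H ab addTb.
  have -> : ~~ (u a < u b)%N = (u b < u a)%N by have := perm_eq_nat u a b; lia.
  by case: ifP.
rewrite key /H.
rewrite -big_split /=; apply: eq_bigr => [[a b]] /= ab; rewrite !permM.
have e1 := perm_eq_nat s a b; have e2 := perm_eq_nat u (s a) (s b).
case: (q _ && q _); last by rewrite !if_same !andbF.
have I01 c : (if c then true else false) = c by case: c.
by rewrite !I01 andbT; lia.
Qed.

Lemma koszul1 (p : 'I_n -> bool) : koszul p 1%g = false.
Proof.
by rewrite /koszul big_pred0 // => [[a b]] /=; rewrite !perm1; case: ltngtP.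
Qed.

Lemma eq_koszul (p q : 'I_n -> bool) s : p =1 q -> koszul p s = koszul q s.
Proof. by move=> e; apply: eq_bigr => ab _; rewrite !e. Qed.

Lemma koszul_adjacent (p : 'I_n -> bool) (i j : 'I_n) :
  j = i.+1 :> nat -> koszul p (tperm i j) = p i && p j.
Proof.
move=> ij; rewrite /koszul (big_pred1 (i, j)) // => [[a b]] /=.
rewrite -[RHS]/((a == i) && (b == j)) -!(inj_eq val_inj) /= ij.
by case: tpermP; case: tpermP;
  do ![move=> -> | move/eqP; rewrite -(inj_eq val_inj) /= => ?]; lia.
Qed.

Lemma tact1 (T : tpow V n) : tact 1%g T = T.
Proof.
apply/ffunP=> g; rewrite ffunE koszul1 expr0 mul1r; congr (T _).
by apply/ffunP=> t; rewrite ffunE perm1.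
Qed.

Lemma tactM (s u : 'S_n) (T : tpow V n) : tact (s * u)%g T = tact u (tact s T).
Proof.
apply/ffunP=> g; rewrite !ffunE mulrA -signr_addb.
have -> : koszul (fun t => ipar (g ((s * u)%g t))) (s * u)%g =
  koszul (fun t => ipar (g (u t))) u
    (+) koszul (fun t => ipar ([ffun t => g (u t)] (s t))) s.
  rewrite addbC (@eq_koszul _ (fun t => ipar (g (u (s t))))); last first.
    by move=> t; rewrite permM.
  rewrite (koszulM (fun t => ipar (g (u t)))); congr (_ (+) _).
  by apply: eq_koszul => t; rewrite ffunE.
by congr (_ * T _); apply/ffunP=> t; rewrite !ffunE permM.
Qed.

Lemma tact_tens (p : 'I_n -> bool) (x : {ffun 'I_n -> V}) (s : 'S_n) :
  (forall t, x t \in spart V (p t)) ->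
  tact s (tens x) = (-1) ^+ koszul p s *: tens [ffun t => x (s^-1 t)%g].
Proof.
move=> hx; apply/ffunP=> g; rewrite !ffunE.
have -> : \prod_(t < n) coord (hbasis V) (g t) ([ffun t => x ((s^-1)%g t)] t) =
  \prod_(t < n) coord (hbasis V) ([ffun t => g (s t)] t) (x t).
  rewrite (reindex_inj (@perm_inj _ s)); apply: eq_bigr => t _.
  by rewrite !ffunE permK.
case: (boolP [forall t, ipar (g (s t)) == p t]) => [/forallP h|].
  suff -> : koszul (fun t => ipar (g (s t))) s = koszul p s by [].
  by apply: eq_koszul => t; exact: (eqP (h t)).
rewrite negb_forall => /existsP[t ht]; rewrite (bigD1 t) //= ffunE.
by rewrite (coord_parity (hbasis_parity V) (hx t) ht) mul0r [RHS]mulr0 mulr0.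
Qed.

Lemma tact_adjacent (p : 'I_n -> bool) (x : {ffun 'I_n -> V}) (i j : 'I_n) :
  j = i.+1 :> nat -> (forall t, x t \in spart V (p t)) ->
  tact (tperm i j) (tens x) =
  (-1) ^+ (p i && p j) *: tens [ffun t => x (tperm i j t)].
Proof. by move=> ij hx; rewrite (tact_tens _ hx) koszul_adjacent // tpermV. Qed.

Lemma vclass_eq0 (T : tpow V n) : (vclass T == 0) = (T \in vrel V n).
Proof.
have capC : (vrel V n :&: (vrel V n)^C = 0)%VS by exact: capv_compl.
have capC' : ((vrel V n)^C :&: vrel V n = 0)%VS by rewrite capvC.
have dec := daddv_pi_add capC' (w := T); apply/eqP/idP => [h|h].
  rewrite -dec; last by rewrite addvC addv_complf memvf.
  have /(congr1 val) := h; rewrite /= vsprojK ?memv_pi // => ->.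
  by rewrite add0r memv_pi.
apply: val_inj; rewrite /= vsprojK ?memv_pi //.
have := dec; rewrite addvC addv_complf => /(_ (memvf _)).
by rewrite (daddv_pi_id capC h) -[in RHS](add0r T) => /addIr.
Qed.

Lemma vclassK (x : vpow V n) : vclass (vsval x) = x.
Proof.
have capC' : ((vrel V n)^C :&: vrel V n = 0)%VS by rewrite capvC capv_compl.
apply: val_inj; rewrite /= vsprojK ?memv_pi // daddv_pi_id //.
exact: subvsP.
Qed.

Lemma vrel_tact (s : 'S_n) (T : tpow V n) : T - tact s T \in vrel V n.
Proof.
apply: (subvP (sumv_sup s _ (subvv _))) => //.
have -> : T - tact s T = (\1 - linfun (tact s))%VF T 
  by rewrite add_lfunE opp_lfunE id_lfunE lfunE.
exact: memv_img (memvf _).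
Qed.

Lemma vclass_tact (s : 'S_n) (T : tpow V n) : vclass (tact s T) = vclass T.
Proof.
apply/eqP; rewrite eq_sym -subr_eq0 -linearB /= vclass_eq0; exact: vrel_tact.
Qed.

Lemma vrel_min (W : vectType F) (g : {linear tpow V n -> W}) :
  (forall s T, g (tact s T) = g T) -> forall T, T \in vrel V n -> g T = 0.
Proof.
move=> gs T /memv_sumP[T_ hT ->]; rewrite linear_sum big1 // => s _.
have /memv_imgP[U _ ->] := hT s isT.
by rewrite add_lfunE opp_lfunE id_lfunE lfunE linearB /= gs subrr.
Qed.

Lemma vee_multilinear : multilinear (@vee F V n).
Proof. exact/multilinear_comp/tens_multilinear. Qed.

Lemma vee_perm (p : 'I_n -> bool) (x : {ffun 'I_n -> V}) (s : 'S_n) :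
  (forall t, x t \in spart V (p t)) ->
  vee x = (-1) ^+ koszul p s *: vee [ffun t => x (s^-1 t)%g].
Proof. by move=> hx; rewrite /vee -(vclass_tact s) (tact_tens s hx) linearZ. Qed.

End ActionTheory.

Lemma vee_mapE (F : fieldType) (V V' : superspace F) (n : nat)
    (h : 'Hom(V, V')) (x : {ffun 'I_n -> V}) : even_map h ->
  vee_map n h (vee x) = vee [ffun t => h (x t)].
Proof.
move=> hh; rewrite /vee_map lfunE /=; set G := fun y : {ffun 'I_n -> V} => _.
have hG y t u : G (upd y t u) = tens (upd [ffun t => h (y t)] t (h u)).
  by congr tens; apply/ffunP=> s; rewrite !ffunE; case: eqP.
have GP : multilinear G.
  by move=> y t a u v; rewrite !hG linearP tens_multilinear.
have comm s T : tlift G (tact s T) = tact s (tlift G T).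
  rewrite [T in LHS]tpow_sum {2}/tlift !linear_sum; apply: eq_bigr => f _.
  rewrite !linearZ /=; congr (_ *: _).
  set y := (X in tact s (tens X)).
  have yp t : y t \in spart V (ipar (f t)).
    by rewrite ffunE; case: (hbasis_parity V).
  rewrite (tact_tens s yp) linearZ /= tliftE // /G.
  rewrite (@tact_tens _ _ _ (fun t => ipar (f t))) => [|t]; last first.
    rewrite ffunE; apply: (subvP (hh _)); exact: memv_img.
  by congr (_ *: tens _); apply/ffunP=> t; rewrite !ffunE.
transitivity (vclass (tlift G (tens x))); last by rewrite tliftE.
apply/eqP; rewrite -subr_eq0 -!linearB /=; apply/eqP.
apply: (vrel_min (g := @vclass F V' n \o tlift G)) => [s T|] /=.
  by rewrite comm vclass_tact.
by rewrite -vclass_eq0 linearB /= vclassK subrr.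
Qed.

Section AssociatedBasis.

Variables (F : fieldType) (V : superspace F) (n : nat).
Variable B : (sdimT V).-tuple V.
Hypothesis hB : parity_basis B.

Lemma veeB_perm (I : multi_index V n) (s : 'S_n) :
  veeB B I =
  (-1) ^+ koszul (fun t => ipar (I t)) s^-1%g *: veeB B (permI I s).
Proof.
rewrite /veeB (@vee_perm _ _ _ (fun t => ipar (I t)) _ s^-1%g) => [|t].
  by congr (_ *: vee _); apply/ffunP=> t; rewrite !ffunE invgK.
by rewrite ffunE; case: hB.
Qed.

Lemma csgnE (I : multi_index V n) (s : 'S_n) :
  veeB B I = csgn B I s *: veeB B (permI I s).
Proof.
rewrite /csgn; case: pickP => [b /eqP //|].
move/(_ (koszul (fun t => ipar (I t)) s^-1%g)).
by rewrite -veeB_perm eqxx.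
Qed.

Lemma cI_mono (k : nat) (I : multi_index V n) (a b : 'I_n) :
  I \in cI V n k -> (a <= b)%N -> (I a <= I b)%N.
Proof.
rewrite inE => /and5P[_ _ /forallP hp /forallP he /forallP ho].
rewrite leq_eqVlt => /predU1P[/val_inj->//|ab].
case: (ltnP b k) => bk; first by have /forallP/(_ b) := he a; rewrite ab bk.
case: (leqP k a) => ka.
  by have /forallP/(_ b) := ho a; rewrite ab ka => /ltnW.
have := hp a; have := hp b; rewrite /ipar bk (leqNgt k a) ka => /eqP h1 /eqP/negbT.
by rewrite -ltnNge => h2; apply: leq_trans h1; apply: ltnW.
Qed.

Lemma cI_odd_inj (k : nat) (I : multi_index V n) (a b : 'I_n) :
  I \in cI V n k -> ipar (I a) -> I a = I b -> a = b.
Proof.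
rewrite inE => /and5P[_ _ /forallP hp _ /forallP ho] oa e.
have ob : ipar (I b) by rewrite -e.
rewrite (eqP (hp a)) in oa; rewrite (eqP (hp b)) in ob.
case: (ltngtP a b) => [ab|ba|/val_inj //].
  by have /forallP/(_ b) := ho a; rewrite ab oa e ltnn.
by have /forallP/(_ a) := ho b; rewrite ba ob e ltnn.
Qed.

Lemma sorted_codom (I : multi_index V n) :
  (forall a b : 'I_n, (a <= b)%N -> (I a <= I b)%N) ->
  sorted leq [seq val (I t) | t <- enum 'I_n].
Proof.
move=> hI; rewrite sorted_map.
have := iota_sorted 0 n; rewrite -val_enum_ord sorted_map.
by apply: sub_sorted => a b; exact: hI.
Qed.

Lemma mono_perm_eq (I J : multi_index V n) (s : 'S_n) :
  (forall a b : 'I_n, (a <= b)%N -> (I a <= I b)%N) ->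
  (forall a b : 'I_n, (a <= b)%N -> (J a <= J b)%N) ->
  J = permI I s -> J = I.
Proof.
move=> hI hJ e; apply/ffunP=> t; apply: val_inj.
suff /eq_in_map/(_ t) : [seq val (J t) | t <- enum 'I_n] =
    [seq val (I t) | t <- enum 'I_n] by apply; rewrite mem_enum.
apply: (sorted_eq leq_trans anti_leq); try exact: sorted_codom.
rewrite {}e (@eq_map _ _ _ ((fun t => val (I t)) \o s)); last first.
  by move=> u; rewrite /= ffunE.
rewrite map_comp; apply: perm_map; apply: uniq_perm.
- by rewrite map_inj_uniq ?enum_uniq //; exact: perm_inj.
- exact: enum_uniq.
move=> u; rewrite mem_enum; apply/mapP; exists (s^-1 u)%g; last by rewrite permKV.
by rewrite mem_enum.
Qed.

Lemma cIn_perm_eq (I J : multi_index V n) (s : 'S_n) :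
  I \in cIn V n -> J \in cIn V n -> J = permI I s -> J = I.
Proof.
move=> /bigcupP[k _ hI] /bigcupP[l _ hJ]; apply: mono_perm_eq.
  by move=> a b; apply: cI_mono hI.
by move=> a b; apply: cI_mono hJ.
Qed.

Lemma exists_sort (f : multi_index V n) : exists s : 'S_n,
  forall a b : 'I_n, (a <= b)%N -> (permI f s a <= permI f s b)%N.
Proof.
pose r (i j : 'I_(sdimT V)) := (i <= j)%N.
pose t := [tuple f i | i < n].
have /tuple_permP[s hs] : perm_eq (sort r t) t by rewrite perm_sort.
exists s => a b ab.
have rs : sorted r (sort r t) by apply: sort_sorted => i j; exact: leq_total.
have rt : transitive r by move=> i j k; exact: leq_trans.
have rr : reflexive r by move=> i; exact: leqnn.
have sz : size (sort r t) = n by rewrite size_sort size_tuple.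
pose i0 := f a.
have E c : permI f s c = nth i0 (sort r t) c.
  rewrite hs -[RHS](tnth_nth i0 [tuple tnth t (s i) | i < n] c).
  by rewrite tnth_mktuple tnth_mktuple ffunE.
rewrite !E; apply: (sorted_leq_nth rt rr i0 rs) => //; rewrite inE sz; exact: ltn_ord.
Qed.

Hypothesis charF : 2%N \notin [pchar F].

Lemma two_neq0 : 2%:R != 0 :> F.
Proof. by move: charF; rewrite inE /=. Qed.

Lemma veeB_repeat (g : multi_index V n) (i j : 'I_n) :
  j = i.+1 :> nat -> ipar (g i) -> g i = g j -> veeB B g = 0.
Proof.
move=> ij oi e; have := veeB_perm g (tperm i j).
rewrite tpermV koszul_adjacent // -e oi /= expr1.
have -> : permI g (tperm i j) = g.
  by apply/ffunP=> t; rewrite ffunE; case: tpermP => // ->.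
rewrite scaleN1r => /eqP; rewrite -addr_eq0 -mulr2n -scaler_nat scaler_eq0.
by rewrite (negPf two_neq0) => /eqP.
Qed.

Lemma mono_cI (g : multi_index V n) :
  (forall a b : 'I_n, (a <= b)%N -> (g a <= g b)%N) ->
  (forall i j : 'I_n, j = i.+1 :> nat -> ipar (g i) -> g i <> g j) ->
  g \in cIn V n.
Proof.
move=> gm gs.
pose Q m := (m == n) || [exists a : 'I_n, (a == m :> nat) && ipar (g a)].
have exQ : exists m, Q m by exists n; rewrite /Q eqxx.
pose k := ex_minn exQ.
have [kQ kmin] : Q k /\ forall m, Q m -> (k <= m)%N by rewrite /k; case: ex_minnP.
have kn : (k <= n)%N by apply: kmin; rewrite /Q eqxx.
have par a : ipar (g a) = (k <= a)%N.
  apply/idP/idP => [oa|ka].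
    by apply: kmin; rewrite /Q; apply/orP; right; apply/existsP; exists a;
      rewrite eqxx.
  case/orP: kQ => [/eqP e|/existsP[b /andP[/eqP e ob]]].
    by have := ltn_ord a; rewrite ltnNge -{1}e ka.
  by apply: leq_trans ob _; apply: gm; rewrite e.
have strict (a b : 'I_n) : (k <= a)%N -> (a < b)%N -> (g a < g b)%N.
  move=> ka ab; pose c := Ordinal (leq_ltn_trans ab (ltn_ord b)).
  have ac : (g a < g c)%N.
    rewrite ltn_neqAle gm ?leqnSn // andbT; apply/negP => /eqP/val_inj.
    by apply: gs => //; rewrite par.
  by apply: leq_trans ac _; apply: gm.
apply/bigcupP; exists (inord k) => //; rewrite inordK // inE kn leq_min leq_subr.
rewrite /= andbT; apply/and4P; split.
- have /fin_all_exists[q hq] (i : 'I_(n - k)) : exists j : 'I_(sdim V true),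
      exists2 a : 'I_n, a = (k + i)%N :> nat & g a = (sdim V false + j)%N :> nat.
    have ai : (k + i < n)%N by have := ltn_ord i; lia.
    have := par (Ordinal ai); rewrite /= leq_addr /ipar => gi.
    have ji : (g (Ordinal ai) - sdim V false < sdim V true)%N.
      by have := ltn_ord (g (Ordinal ai)); lia.
    by exists (Ordinal ji), (Ordinal ai); rewrite //= subnKC.
  rewrite -[(n - k)%N]card_ord -[sdim V true]card_ord; apply: (leq_card q).
  move=> i i' e; have [a ha ga] := hq i; have [b hb gb] := hq i'.
  have gab : g a = g b :> nat by rewrite ga gb e.
  apply: val_inj => /=; case: (ltngtP a b) => ab; last lia.
    by have := strict a b; rewrite ha leq_addr -ha ab gab ltnn => /(_ isT isT).
  by have := strict b a; rewrite hb leq_addr -hb ab gab ltnn => /(_ isT isT).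
- by apply/forallP=> a; rewrite par.
- apply/forallP=> a; apply/forallP=> b; apply/implyP=> /andP[ab _].
  by apply: gm; exact: ltnW.
by apply/forallP=> a; apply/forallP=> b; apply/implyP=> /andP[]; exact: strict.
Qed.

Lemma veeB_span (f : multi_index V n) : veeB B f \in <<ebasis n B>>%VS.
Proof.
have [s hs] := exists_sort f; rewrite (veeB_perm f s); apply: memvZ.
move: (permI f s) hs => g gm.
case: (boolP [exists i : 'I_n, exists j : 'I_n,
         [&& j == i.+1 :> nat, ipar (g i) & g i == g j]]).
  move=> /existsP[i /existsP[j /and3P[/eqP ij oi /eqP e]]].
  by rewrite (veeB_repeat ij oi e) mem0v.
move=> nex; have gI : g \in cIn V n.
  apply: mono_cI => // i j ij oi e; case/negP: nex.
  by apply/existsP; exists i; apply/existsP; exists j; rewrite ij oi e !eqxx.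
apply: memv_span; apply/tnthP; exists (enum_rank_in gI g).
by rewrite tnth_mktuple enum_rankK_in.
Qed.

Lemma vee_span (x : {ffun 'I_n -> V}) : vee x \in <<ebasis n B>>%VS.
Proof.
pose U := <<ebasis n B>>%VS.
pose phi (x : {ffun 'I_n -> V}) := vee x - projv U (vee x).
suff /eqP : phi x = 0 by rewrite subr_eq0 => /eqP->; exact: memv_proj.
apply: (multilinear_eq0 (proj1 hB)) => [y t a u v|f].
  by rewrite /phi vee_multilinear linearP scalerBr opprD addrACA.
by rewrite /phi projv_id ?subrr //; exact: veeB_span.
Qed.

Lemma ebasis_span : <<ebasis n B>>%VS = fullv.
Proof.
apply/eqP; rewrite eqEsubv subvf /=; apply/subvP=> v _.
rewrite -(vclassK v) [vsval v]tpow_sum linear_sum; apply: memv_suml => f _.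
by rewrite linearZ; apply: memvZ; exact: vee_span.
Qed.

Definition coordI (I : multi_index V n) (x : {ffun 'I_n -> V}) : F^o :=
  \prod_(t < n) coord B (I t) (x t).

Lemma coordI_multilinear I : multilinear (coordI I).
Proof.
move=> x t a u v.
have E w : coordI I (upd x t w) =
  coord B (I t) w * \prod_(s < n | s != t) coord B (I s) (x s).
  rewrite /coordI (bigD1 t) //= ffunE eqxx; congr (_ * _).
  by apply: eq_bigr => s /negPf; rewrite ffunE => ->.
by rewrite !E linearP /= mulrDl -mulrA.
Qed.

Lemma coordI_B (I J : multi_index V n) :
  coordI I [ffun t => tnth B (J t)] = (I == J)%:R.
Proof.
have fB := basis_free (proj1 hB).
rewrite /coordI; case: eqP => [->|ne].
  by rewrite big1 // => t _; rewrite ffunE (tnth_nth 0) coord_free ?eqxx.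
have [t ht] : exists t, J t != I t.
  apply/existsP; rewrite -negb_forall; apply/negP=> /forallP h; apply: ne.
  by apply/ffunP=> t; apply/esym/eqP/h.
by rewrite (bigD1 t) //= ffunE (tnth_nth 0) coord_free // (negPf ht) mul0r.
Qed.

Definition stabI (I : multi_index V n) : {set 'S_n} :=
  [set s : 'S_n | permI I s^-1%g == I].

Lemma stabI_group (I : multi_index V n) : group_set (stabI I).
Proof.
have E (s : 'S_n) : (s \in stabI I) = [forall t, I (s t) == I t].
  rewrite inE; apply/eqP/forallP => [e t|h].
    by rewrite -{1}e ffunE permK.
  by apply/ffunP=> t; rewrite ffunE -[in RHS](permKV s t); apply/esym/eqP/h.
apply/group_setP; split=> [|s u].
  by rewrite E; apply/forallP=> t; rewrite perm1.
rewrite !E => /forallP hs /forallP hu; apply/forallP=> t.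
by rewrite permM (eqP (hu _)).
Qed.

Lemma stabI_koszul (I : multi_index V n) (s : 'S_n) :
  I \in cIn V n -> s \in stabI I -> koszul (fun t => ipar (I t)) s = false.
Proof.
move=> /bigcupP[k _ hI]; rewrite inE => /eqP e.
have fx t : ipar (I t) -> s t = t.
  move=> ot; apply/esym/(cI_odd_inj hI ot).
  by rewrite -[in RHS]e ffunE permK.
rewrite /koszul big1 // => [[a b]] /= /andP[ab sba].
by apply/negP=> /andP[/fx ea /fx eb]; move: sba; rewrite ea eb ltnNge ltnW.
Qed.

Lemma stabI_card (I : multi_index V n) : dim_hyp V n -> I \in cIn V n ->
  #|stabI I|%:R != 0 :> F.
Proof.
move=> [_ hd1] hI; have := hI => /bigcupP[k _ hIk].
pose G := Group (stabI_group I).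
have dv : (#|stabI I| %| n`!)%N.
  by have := cardSg (subsetT G); rewrite cardsT card_Sn.
case: (posnP (sdim V false)) => [d0|/hd1 hc].
  suff -> : stabI I = 1%g by rewrite cards1 oner_neq0.
  apply/setP=> s; rewrite inE in_set1.
  apply/eqP/eqP => [e|->]; last by apply/ffunP=> t; rewrite ffunE invg1 perm1.
  apply/permP=> t; rewrite perm1; apply/esym/(cI_odd_inj hIk).
    by rewrite /ipar; move: (leq0n (I t)); rewrite -[X in (X <= _)%N]d0.
  by rewrite -[in RHS]e ffunE permK.
apply/negP=> e; have Gpos : (0 < #|stabI I|)%N by exact: (cardG_gt0 G).
have [p pF] := natf0_pchar Gpos e.
case: hc => [hc|[q qF nq]]; first by move: pF; rewrite hc.
have eqpq : p = q by apply/eqP; have := pcharf_eq qF p; rewrite pF inE => <-.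
move: e; rewrite -(dvdn_pcharf pF) => pd.
have := dvdn_trans pd dv; rewrite eqpq in pF *; have qp := pcharf_prime pF.
elim: (n) nq => [|m IH] mq; first by rewrite Euclid_dvd1.
rewrite factS Euclid_dvdM // => /orP[/(dvdn_leq (ltn0Sn m))|].
  by rewrite leqNgt mq.
exact/IH/ltnW.
Qed.

Lemma ebasis_free : dim_hyp V n -> free (ebasis n B).
Proof.
move=> hd; pose sym I : 'Hom(tpow V n, F^o) :=
  \sum_(s : 'S_n) (linfun (tlift (coordI I)) \o linfun (tact s))%VF.
have symE I T : sym I T = \sum_(s : 'S_n) tlift (coordI I) (tact s T).
  by rewrite sum_lfunE; apply: eq_bigr => s _; rewrite comp_lfunE !lfunE.
have sym_tact I s T : sym I (tact s T) = sym I T.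
  rewrite !symE [RHS](reindex_inj (mulgI s)) /=.
  by apply: eq_bigr => u _; rewrite tactM.
pose e (J : multi_index V n) : tpow V n := tens [ffun t => tnth B (J t)].
have sym_e I J : I \in cIn V n -> J \in cIn V n ->
    sym I (e J) = (if I == J then #|stabI I| else 0%N)%:R.
  move=> hI hJ; rewrite symE.
  have E s : tlift (coordI I) (tact s (e J)) =
      (-1) ^+ koszul (fun t => ipar (J t)) s * (permI J s^-1%g == I)%:R.
    rewrite (@tact_tens _ _ _ (fun t => ipar (J t))) => [|t]; last first.
      by rewrite ffunE; case: hB.
    rewrite linearZ /= tliftE; last exact: coordI_multilinear.
    rewrite eq_sym -coordI_B; congr (_ * coordI _ _).
    by apply/ffunP=> t; rewrite !ffunE.
  rewrite (eq_bigr _ (fun s _ => E s)); case: eqP => [eIJ|ne]; last first.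
    rewrite big1 // => s _; case: eqP => [e1|_]; last by rewrite mulr0.
    by case: ne; apply: (cIn_perm_eq hJ hI (esym e1)).
  rewrite -eIJ (bigID (mem (stabI I))) /= addrC big1 => [|s ns]; last first.
    by rewrite inE in ns; rewrite (negPf ns) mulr0.
  rewrite add0r (eq_bigr (fun=> 1)) ?sumr_const // => s hs.
  by rewrite stabI_koszul // mul1r; move: hs; rewrite inE => ->.
apply/freeP => k hk i.
have : \sum_(j < #|cIn V n|) k j *: e (enum_val j) \in vrel V n.
  rewrite -vclass_eq0 linear_sum -[X in _ == X]hk; apply/eqP.
  by apply: eq_bigr => j _; rewrite linearZ -tnth_nth tnth_mktuple.
pose I := enum_val i : multi_index V n.
move/(vrel_min (sym_tact I)); rewrite linear_sum (bigD1 i) //= big1 => [|j ne].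
  rewrite addr0 linearZ /= sym_e ?eqxx ?enum_valP // => /eqP; rewrite mulf_eq0.
  by rewrite (negPf (stabI_card hd _)) ?enum_valP // orbF => /eqP.
rewrite linearZ /= sym_e ?enum_valP // (inj_eq enum_val_inj) eq_sym (negPf ne).
by rewrite [LHS]mulr0.
Qed.

Lemma ebasis_basis : dim_hyp V n -> basis_of fullv (ebasis n B).
Proof.
by move=> hd; rewrite /basis_of ebasis_free // ebasis_span eqxx.
Qed.

Lemma csgn_unique (I : multi_index V n) (s : 'S_n) (b : bool) :
  dim_hyp V n -> I \in cIn V n ->
  veeB B I = (-1) ^+ b *: veeB B (permI I s) -> csgn B I s = (-1) ^+ b.
Proof.
move=> hd hI eb; have := csgnE I s; rewrite /csgn.
set c := odflt _ _ => ec; case: (eqVneq c b) => [->//|cb].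
have cE : c = ~~ b by move: cb; case: (c); case: (b).
have u0 : veeB B I != 0.
  have := ebasis_free hd; rewrite free_directv => /andP[h _].
  apply: contraNneq h => <-; apply/tnthP; exists (enum_rank_in hI I).
  by rewrite tnth_mktuple enum_rankK_in.
case/eqP: u0; apply/eqP.
suff : veeB B I + veeB B I == 0.
  by rewrite -mulr2n -scaler_nat scaler_eq0 (negPf two_neq0).
by rewrite {1}eb ec cE signrN scaleNr subrr.
Qed.

Lemma csgn_type (k : nat) (I : multi_index V n) (s : 'S_n) :
  dim_hyp V n -> I \in cI V n k ->
  csgn B I s = (-1) ^+ koszul (fun t => (k <= t)%N) s^-1%g.
Proof.
move=> hd hI; have hIn : I \in cIn V n.
  move: (hI); rewrite inE => /andP[kn _]; apply/bigcupP.
  by exists (inord k); rewrite ?inordK.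
apply: csgn_unique => //; rewrite [LHS](veeB_perm _ s); congr (_ ^+ _ *: _).
congr nat_of_bool; apply: eq_koszul => t.
by move: hI; rewrite inE => /and5P[_ _ /forallP h _ _]; exact: (eqP (h t)).
Qed.

End AssociatedBasis.

(* Main.v *)
Require Import Defs.
From HB Require Import structures.
From mathcomp Require Import all_boot all_order all_algebra all_fingroup.

Set Implicit Arguments.
Unset Strict Implicit.
Unset Printing Implicit Defensive.

Import GRing.Theory.
Local Open Scope ring_scope.

(* Expanding a product of vectors multilinearly in the basis gives one term
   for each multi-index f.  Sorting f either exhibits a repeated odd index, and
   the term vanishes, or exhibits f as a rearrangement of exactly one I in
   [cIn]; collecting the rearrangements of I gives the superminor.  Part 2 is
   the same expansion applied to the images of the basis vectors.  For the
   vanishing, a nonzero term of a superminor matches the odd positions of I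
   with the odd columns, so their numbers agree. *)

(** Both sides are multilinear, so it suffices to compare them on tuples of basis vectors, where a
    single coefficient survives. *)
Lemma multilinear_expand (F : fieldType) (V : superspace F) (n : nat)
    (B : (sdimT V).-tuple V) (W : lmodType F) (phi : {ffun 'I_n -> V} -> W) :
  parity_basis B -> multilinear phi ->
  forall x, phi x = \sum_(f : multi_index V n)
    (coordI B f x : F) *: phi [ffun t => tnth B (f t)].
Proof.
move=> hB phiP; apply: (multilinear_ext (proj1 hB) phiP) => [x t a u v | g].
  rewrite scaler_sumr -big_split; apply: eq_bigr => f _ /=.
  by rewrite coordI_multilinear scalerDl scalerA.
rewrite (bigD1 g) //= coordI_B // eqxx scale1r big1 ?addr0 // => f ne.
by rewrite coordI_B // (negPf ne) scale0r.
Qed.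

Lemma coord_tnth_sum (F : fieldType) (V : vectType F) (d : nat)
    (B : d.-tuple V) (a : 'I_d -> F) (i : 'I_d) :
  free B -> coord B i (\sum_(j < d) a j *: tnth B j) = a i.
Proof.
move=> fB; under eq_bigr do rewrite (tnth_nth 0).
exact: coord_sum_free.
Qed.

Section Expansion.

Variables (F : fieldType) (V : superspace F) (n : nat).
Variable B : (sdimT V).-tuple V.
Hypothesis hB : parity_basis B.
Hypothesis charF : 2%N \notin [pchar F].

Lemma permIM (f : multi_index V n) (s u : 'S_n) :
  permI (permI f s) u = permI f (u * s)%g.
Proof. by apply/ffunP=> t; rewrite !ffunE permM. Qed.

Lemma permIK (f : multi_index V n) (s : 'S_n) : permI (permI f s) s^-1%g = f.
Proof. by apply/ffunP=> t; rewrite !ffunE permKV. Qed.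

(** Tuples in [cIn] are weakly increasing, so an orbit under rearrangement contains at most one of
    them. *)
Lemma permI_cIn_inj (I J : multi_index V n) (s u : 'S_n) :
  I \in cIn V n -> J \in cIn V n -> permI I s = permI J u -> J = I.
Proof.
move=> hI hJ e; apply: (@cIn_perm_eq _ _ _ _ _ (u^-1 * s)%g) => //.
by rewrite -permIM e permIK.
Qed.

Lemma veeB_rearrange (f : multi_index V n) : veeB B f != 0 ->
  exists I, exists2 s : 'S_n, I \in cIn V n & f = permI I s.
Proof.
move=> f0; have [s gm] := exists_sort f.
exists (permI f s), s^-1%g; last by rewrite permIK.
apply: mono_cI => // i j ij oi e; case/eqP: f0.
by rewrite (veeB_perm hB f s) (veeB_repeat hB charF ij oi e) scaler0.
Qed.

(** A sign is its own inverse, so [csgnE] can be read in the other direction. *)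
Lemma csgn_veeB (I : multi_index V n) (s : 'S_n) :
  veeB B (permI I s) = csgn B I s *: veeB B I.
Proof.
rewrite [in RHS](csgnE hB I s) scalerA /csgn -signr_addb addbb.
by rewrite scale1r.
Qed.

(** Keeping the column tuple [J] arbitrary serves both parts: the identity for the vectors w_j, a
    basis tuple for the images under h. *)
Lemma vee_superminor (S : multi_index V n -> {set 'S_n}) (c : nat)
    (A : 'M[F]_(sdimT V, c)) (J : {ffun 'I_n -> 'I_c}) (x : {ffun 'I_n -> V}) :
  (forall I, I \in cIn V n -> rearrangements I (S I)) ->
  (forall i t, coord B i (x t) = A i (J t)) ->
  vee x = \sum_(I in cIn V n) superminor B (S I) A I J *: veeB B I.
Proof.
move=> hS hx; rewrite (multilinear_expand hB (@vee_multilinear F V n)).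
pose G (f : multi_index V n) := (coordI B f x : F) *: veeB B f.
(* Each superminor term becomes a sum over all multi-indices, cut down to the rearrangements of [I],
   so that the two sums can be exchanged. *)
have E I : I \in cIn V n ->
    superminor B (S I) A I J *: veeB B I =
    \sum_f if f \in permI I @: S I then G f else 0.
  move=> hI; have [inj _] := hS I hI.
  rewrite -big_mkcond big_imset //= scaler_suml; apply: eq_bigr => s _.
  rewrite /G csgn_veeB scalerA mulrC; congr (_ * _ *: _).
  by apply: eq_bigr => t _; rewrite hx ffunE.
rewrite (eq_bigr _ E) exchange_big /=; apply: eq_bigr => f _.
(* For fixed [f] with nonzero product, exactly one [I] has [f] among its rearrangements. *)
rewrite -[LHS]/(G f); case: (eqVneq (veeB B f) 0) => [f0|].
  by rewrite /G f0 scaler0 big1 // => I _; case: ifP.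
case/veeB_rearrange => I [s hI fE]; have [_ /(_ s)[u uS uE]] := hS I hI.
have fS : f \in permI I @: S I by rewrite fE -uE; apply: imset_f.
rewrite (bigD1 I) //= fS big1 ?addr0 // => K /andP[hK ne].
case: ifP => // /imsetP[v _ vE]; case/eqP: ne.
by apply: (@permI_cIn_inj I K s v); rewrite // -fE.
Qed.

Lemma card_ord_geq (k : nat) : #|[set t : 'I_n | (k <= t)%N]| = (n - k)%N.
Proof.
rewrite -sum1dep_card -(big_geq_mkord _ _ predT (fun=> 1%N)).
by rewrite sum_nat_const_nat muln1.
Qed.

(** Here [r] is the number of even columns, and the condition on [A] is its block form on the
    columns selected by [J]. *)
Lemma superminor_eq0 (S : {set 'S_n}) (c k r : nat) (A : 'M[F]_(sdimT V, c))
    (I : multi_index V n) (J : {ffun 'I_n -> 'I_c}) :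
  I \in cI V n k -> (r <= n)%N -> k <> r ->
  (forall i (t : 'I_n), ipar i != (r <= t)%N -> A i (J t) = 0) ->
  superminor B S A I J = 0.
Proof.
rewrite inE => /and5P[kn _ /forallP par _ _] rn kr hA.
rewrite /superminor big1 // => s _.
case: (boolP [forall t, ipar (I (s t)) == (r <= t)%N]) => [/forallP h|].
  (* If all parities matched, [s] would map the odd columns bijectively onto the odd positions of
     [I], giving n - k = n - r. *)
  case: kr; rewrite -(subKn kn) -(subKn rn); congr (n - _)%N.
  rewrite -(card_ord_geq k) -(card_ord_geq r).
  rewrite -(card_imset _ (@perm_inj _ s^-1%g)).
  rewrite (can_imset_pre _ (permKV s)); apply: eq_card => t.
  by rewrite !inE -(eqP (h t)) (eqP (par _)).
rewrite negb_forall => /existsP[t ht].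
by rewrite (bigD1 t) //= hA // mul0r mulr0.
Qed.

End Expansion.

Theorem proposition6p10 (F : fieldType) (n : nat) (V V' : superspace F)
    (B : (sdimT V).-tuple V) (B' : (sdimT V').-tuple V')
    (S : multi_index V n -> {set 'S_n}) (S' : multi_index V' n -> {set 'S_n})
    (charF : 2%N \notin [pchar F]) (n_ge2 : (2 <= n)%N)
    (V_neq0 : (0 < \dim {: V})%N) (V'_neq0 : (0 < \dim {: V'})%N)
    (hV : dim_hyp V n) (hV' : dim_hyp V' n)
    (hB : parity_basis B) (hB' : parity_basis B')
    (hS : forall I, I \in cIn V n -> rearrangements I (S I))
    (hS' : forall I, I \in cIn V' n -> rearrangements I (S' I)) :
  (forall (r : nat) (w : {ffun 'I_n -> V}) (A : 'M[F]_(sdimT V, n)),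
     (r <= n)%N -> (n - r <= minn (sdim V true) n)%N ->
     (forall j : 'I_n, w j \in spart V (r <= j)%N) ->
     (forall j : 'I_n, w j = \sum_(i < sdimT V) A i j *: tnth B i) ->
     let J : {ffun 'I_n -> 'I_n} := [ffun j => j] in
     vee w = \sum_(I in cIn V n) superminor B (S I) A I J *: veeB B I /\
     (forall I, I \in cIn V n -> I \notin cI V n r ->
        superminor B (S I) A I J = 0)) /\
  (forall h : 'Hom(V, V'), even_map h ->
     let A := coordmx B B' h in
     coordmx (ebasis n B) (ebasis n B') (vee_map n h) = vee_mx B' S' A /\
     (forall (r s : nat) (I : multi_index V n) (I' : multi_index V' n),
        I \in cI V n r -> I' \in cI V' n s -> r <> s ->
        superminor B' (S' I') A I' I = 0)).
Proof.
split=> [r w A rn _ hw wA J | h hh A].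
  have hA i j : coord B i (w j) = A i j.
    by rewrite wA coord_tnth_sum // (basis_free (proj1 hB)).
  split=> [|I /bigcupP[k _ hI] nI].
    by apply: vee_superminor => // i t; rewrite hA ffunE.
  apply: (superminor_eq0 _ _ hI rn) => [kr | i t it].
    by move: nI; rewrite -kr hI.
  (* The off-diagonal blocks of [A] vanish because each [w t] is homogeneous. *)
  by rewrite ffunE -hA (coord_parity hB (hw t)).
have cA i j : coord B' i (h (tnth B j)) = A i j by rewrite mxE.
split=> [|r s I I' hI hI' rs].
  apply/matrixP=> i j; rewrite !mxE tnth_mktuple /veeB vee_mapE //.
  rewrite (vee_superminor hB' charF (S := S') (A := A) (J := enum_val j) hS').
    (* Indexing the sum by ordinals turns it into a combination of [ebasis], whose coordinates are
       its coefficients by freeness. *)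
    rewrite big_enum_val /=.
    under eq_bigr => k _ do
      rewrite -[veeB _ _](tnth_mktuple (fun k => veeB B' (enum_val k))).
    by rewrite coord_tnth_sum // ebasis_free.
  by move=> k t; rewrite !ffunE cA.
have:= hI; rewrite inE => /and5P[rn _ /forallP par _ _].
apply: (superminor_eq0 _ _ hI' rn) => [sr|i t it]; first by case: rs.
(* As h is even, the image of the basis vector of index [I t] keeps its parity, which the type of
   [I] gives as r <= t. *)
rewrite -cA; apply: (coord_parity hB' _ it); apply: (subvP (hh _)).
by rewrite memv_img // -(eqP (par t)); case: hB.
Qed.
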